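(* Fix an initial exchange matrix $B^0$ and initial coefficients $p_1,\dots,p_n\in\mathbb P$ at $v_0$, and let $\mathcal S=\mathbb Q\mathbb P_{\mathrm{sf}}(y_1,\dots,y_n)$. For every $v\in\mathbb T^n$ and $j\in[1,n]$, writing $B_v=(b^v_{ij})$, $$\widetilde Y_{j;v}=\Big(\prod_{i=1}^n(F_{i;v}^{-b^v_{ij}})^{\mathbb P}(p_1,\dots,p_n)\Big)\Big(\prod_{i=1}^n(F_{i;v}^{b^v_{ij}})^{\mathcal S}(p_1y_1,\dots,p_ny_n)\Big)\,\mathbf y^{\mathbf c_{j;v}},$$ where $\mathbf y^{\mathbf c_{j;v}}=\prod_i y_i^{c_{ij;v}}$.
   Context: A semifield $(\mathbb P,\oplus,\cdot,1)$ satisfies the field axioms except that $\oplus$ need not have a neutral element or inverses. For $p\in\mathbb P$: $p^+=p/(p\oplus1)$, $p^-=1/(p\oplus1)$, and $p^{[\![x]\!]}=p^-,1,p^+$ according as $x<0,x=0,x>0$. $\mathbb Q_{\mathrm{sf}}(S)$ is the universal semifield of subtraction-free rational functions in the set $S$; for any semifield $\mathbb P'$ and $q_i\in\mathbb P'$ there is a unique semifield morphism sending the generators $s_i\mapsto q_i$, and the image of $f$ is written $f^{\mathbb P'}(q_1,\dots)$. $\mathbb Q\mathbb P$ is the fraction field of the group ring $\mathbb Z\mathbb P$, and $\mathbb Q\mathbb P_{\mathrm{sf}}(u_1,\dots,u_n)$ is the semifield of ratios of nonzero polynomials in the $u_i$ with coefficients nonnegative integer combinations of elements of $\mathbb P$.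 Tropical semifield $\mathrm{Trop}(z_i:i\in I)$: free abelian group on the $z_i$ with $\prod z_i^{a_i}\oplus\prod z_i^{b_i}=\prod z_i^{\min(a_i,b_i)}$. Matrix mutation: $b'_{ij}=-b_{ij}$ if $i=k$ or $j=k$, else $b_{ij}+\operatorname{sgn}(b_{ik})[b_{ik}b_{kj}]_+$. $Y$-seed mutation in a semifield: $y'_k=y_k^{-1}$, $y'_j=y_j(1\oplus y_k^{-\operatorname{sgn}(b_{kj})})^{-b_{kj}}$ ($j\ne k$). $Y$-seed with coefficients $(\mathbf y,\mathbf p,B)$ mutates by mutating $(\mathbf p,B)$ as a $Y$-seed in $\mathbb P$, $y'_k=y_k^{-1}$, $y'_j=y_j\big(p_k^{[\![b_{kj}]\!]}+p_k^{[\![-b_{kj}]\!]}y_k^{-\operatorname{sgn}(b_{kj})}\big)^{-b_{kj}}$ for $j\neq k$. Patterns are assignments of seeds to vertices of the $n$-regular edge-labeled tree $\mathbb T^n$ (initial vertex $v_0$) compatible with mutation along edges. $Y_{j;v}\in\mathbb Q_{\mathrm{sf}}(y_1,\dots,y_n)$: components of the $Y$-pattern with initial seed $((y_1,\dots,y_n),B^0)$; $B_v$ the exchange matrices. $\widetilde Y_{j;v}$: components of the $Y$-pattern with coefficients with initial seed $((y_1,\dots,y_n),(p_1,\dots,p_n),B^0)$. c-vectors: $\mathbf c_{j;v}=(c_{1j;v},\dots,c_{nj;v})\in\mathbb Z^n$ is defined by $Y_{j;v}^{\mathrm{Trop}(y_1,\dots,y_n)}(y_1,\dots,y_n)=\prod_i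 y_i^{c_{ij;v}}$. F-polynomials: a cluster pattern with coefficients in a semifield $\mathbb P$ assigns to each $v$ a triple $(\mathbf x_v,\mathbf p_v,B_v)$, with $(\mathbf p_v,B_v)$ a $Y$-pattern in $\mathbb P$ and clusters mutating by $x'_j=x_j$ ($j\ne k$), $x'_k=\big(p_k^-\prod_{b_{ik}<0}x_i^{-b_{ik}}+p_k^+\prod_{b_{ik}>0}x_i^{b_{ik}}\big)/x_k$. Take principal coefficients: $\mathbb P=\mathrm{Trop}(z_1,\dots,z_n)$, initial seed $((x_1,\dots,x_n),(z_1,\dots,z_n),B^0)$. Its cluster variables are Laurent polynomials $X^{\mathrm{FZ}}_{j;v}\in\mathbb Z[x_1^{\pm1},\dots,x_n^{\pm1};z_1,\dots,z_n]$, and $F_{j;v}(z_1,\dots,z_n):=X^{\mathrm{FZ}}_{j;v}(1,\dots,1;z_1,\dots,z_n)$; each $F_{j;v}$ is regarded as an element of $\mathbb Q_{\mathrm{sf}}(z_1,\dots,z_n)$, so that $(F^{\pm b}_{i;v})^{\mathbb P'}(q_1,\dots,q_n)$ denotes its image under $z_i\mapsto q_i$. *)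

(* Defs.v *)
From HB Require Import structures.
From mathcomp Require Import all_boot all_order all_algebra.
From Stdlib Require Import Permutation.
Set Implicit Arguments.
Unset Strict Implicit.
Unset Printing Implicit Defensive.
Import Order.TTheory GRing.Theory Num.Theory.
Local Open Scope ring_scope.

Record sfops := SFOps {
  sf_car :> Type;
  sf_add : sf_car -> sf_car -> sf_car;
  sf_mul : sf_car -> sf_car -> sf_car;
  sf_one : sf_car;
  sf_inv : sf_car -> sf_car }.
Arguments sf_add : clear implicits.
Arguments sf_mul : clear implicits.
Arguments sf_one : clear implicits.
Arguments sf_inv : clear implicits.

Definition is_semifield (P : sfops) : Prop :=
  associative (sf_add P) /\ commutative (sf_add P) /\
  associative (sf_mul P) /\ commutative (sf_mul P) /\
  left_id (sf_one P) (sf_mul P) /\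
  (forall x : P, sf_mul P (sf_inv P x) x = sf_one P) /\
  left_distributive (sf_mul P) (sf_add P).

Section Generic.
Variable P : sfops.

Definition sf_div (x y : P) : P := sf_mul P x (sf_inv P y).

Fixpoint sf_expn (x : P) (m : nat) : P :=
  match m with 0%N => sf_one P | m'.+1 => sf_mul P x (sf_expn x m') end.

Definition sf_expz (x : P) (k : int) : P :=
  match k with Posz m => sf_expn x m | Negz m => sf_inv P (sf_expn x m.+1) end.

Definition sf_prod (n : nat) (f : 'I_n -> P) : P :=
  foldr (fun i acc => sf_mul P (f i) acc) (sf_one P) (enum 'I_n).

Definition sf_plus (p : P) : P := sf_div p (sf_add P p (sf_one P)).
Definition sf_minus (p : P) : P := sf_div (sf_one P) (sf_add P p (sf_one P)).
Definition sf_bracket (p : P) (x : int) : P :=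
  if x < 0 then sf_minus p else if x == 0 then sf_one P else sf_plus p.
End Generic.

Definition skew_symmetrizable (n : nat) (B : 'M[int]_n) : Prop :=
  exists d : 'I_n -> nat, (forall i, (0 < d i)%N) /\
    forall i j, (d i)%:Z * B i j = - ((d j)%:Z * B j i).

Definition mutmx (n : nat) (k : 'I_n) (B : 'M[int]_n) : 'M[int]_n :=
  \matrix_(i, j) if (i == k) || (j == k) then - B i j
                 else B i j + sgz (B i k) * Num.max 0 (B i k * B k j).

(* A vertex v of T^n is encoded by the (reduced) sequence of edge labels
   of the unique path from v0 to v; the path is followed left to right. *)
Definition reduced (n : nat) (v : seq 'I_n) : bool :=
  sorted (fun a b : 'I_n => a != b) v.

Fixpoint Bpat (n : nat) (B0 : 'M[int]_n) (v : seq 'I_n) : 'M[int]_n :=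
  match v with [::] => B0 | k :: v' => Bpat (mutmx k B0) v' end.

Definition ymut (P : sfops) (n : nat) (k : 'I_n) (B : 'M[int]_n)
    (y : 'I_n -> P) : 'I_n -> P :=
  fun j => if j == k then sf_inv P (y k)
    else sf_mul P (y j)
      (sf_expz (sf_add P (sf_one P) (sf_expz (y k) (- sgz (B k j)))) (- B k j)).

Fixpoint ypat (P : sfops) (n : nat) (B : 'M[int]_n) (y : 'I_n -> P)
    (v : seq 'I_n) : 'I_n -> P :=
  match v with [::] => y | k :: v' => ypat (mutmx k B) (ymut k B y) v' end.

Definition ycmut (P A : sfops) (iota : P -> A) (n : nat) (k : 'I_n)
    (B : 'M[int]_n) (p : 'I_n -> P) (y : 'I_n -> A) : 'I_n -> A :=
  fun j => if j == k then sf_inv A (y k)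
    else sf_mul A (y j)
      (sf_expz (sf_add A (iota (sf_bracket (p k) (B k j)))
                         (sf_mul A (iota (sf_bracket (p k) (- B k j)))
                                   (sf_expz (y k) (- sgz (B k j)))))
               (- B k j)).

Fixpoint ycpat (P A : sfops) (iota : P -> A) (n : nat) (B : 'M[int]_n)
    (p : 'I_n -> P) (y : 'I_n -> A) (v : seq 'I_n) : 'I_n -> A :=
  match v with [::] => y
  | k :: v' => ycpat iota (mutmx k B) (ymut k B p) (ycmut iota k B p y) v' end.

Definition cmut (P A : sfops) (iota : P -> A) (n : nat) (k : 'I_n)
    (B : 'M[int]_n) (p : 'I_n -> P) (x : 'I_n -> A) : 'I_n -> A :=
  fun j => if j == k then
    sf_div (sf_add A
      (sf_mul A (iota (sf_minus (p k)))
         (sf_prod (fun i => if B i k < 0 then sf_expz (x i) (- B i k) else sf_one A)))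
      (sf_mul A (iota (sf_plus (p k)))
         (sf_prod (fun i => if 0 < B i k then sf_expz (x i) (B i k) else sf_one A))))
      (x k)
    else x j.

Fixpoint cpat (P A : sfops) (iota : P -> A) (n : nat) (B : 'M[int]_n)
    (p : 'I_n -> P) (x : 'I_n -> A) (v : seq 'I_n) : 'I_n -> A :=
  match v with [::] => x
  | k :: v' => cpat iota (mutmx k B) (ymut k B p) (cmut iota k B p x) v' end.

(* Tropical semifield Trop(z_1..z_n): exponent vectors in Z^n           *)
Definition trop (n : nat) : sfops :=
  @SFOps {ffun 'I_n -> int}
    (fun a b => [ffun i => Order.min (a i) (b i)])
    (fun a b => [ffun i => a i + b i])
    [ffun => 0]
    (fun a => [ffun i => - a i]).

Definition delta (n : nat) (i : 'I_n) : {ffun 'I_n -> int} :=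
  [ffun j => (j == i)%:Z].

Definition unitsf : sfops := @SFOps unit (fun _ _ => tt) (fun _ _ => tt) tt (fun _ => tt).

(* The semifield Q P_sf(u_1..u_n) of ratios of nonzero polynomials     *)
(* (Laurent allowed) in u_1..u_n with coefficients in N[P], inside      *)
(* the field Q P(u_1..u_n).  A polynomial is a finite multiset (list)   *)
(* of monomials p * u^e (p in P, e in Z^n); it is nonzero iff the list  *)
(* is nonempty.  Two ratios are equal iff their cross products agree    *)
(* in Z[P x Z^n], i.e. as multisets of monomials.                       *)
(* With P = unitsf this is the universal semifield Q_sf(u_1..u_n).      *)
Section Frac.
Variables (P : sfops) (n : nat).

Definition mono := (sf_car P * {ffun 'I_n -> int})%type.
Definition mmul (a b : mono) : mono := (sf_mul P a.1 b.1, [ffun i => a.2 i + b.2 i]).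
Definition mone : mono := (sf_one P, [ffun => 0]).
Definition npoly := seq mono.
Definition pmul (p q : npoly) : npoly := [seq mmul a b | a <- p, b <- q].

Record frac := Frac { fnum : npoly; fden : npoly }.

Definition fadd (a b : frac) : frac :=
  Frac (pmul (fnum a) (fden b) ++ pmul (fnum b) (fden a)) (pmul (fden a) (fden b)).
Definition fmul (a b : frac) : frac :=
  Frac (pmul (fnum a) (fnum b)) (pmul (fden a) (fden b)).
Definition fone : frac := Frac [:: mone] [:: mone].
Definition finv (a : frac) : frac := Frac (fden a) (fnum a).

Definition fracsf : sfops := @SFOps frac fadd fmul fone finv.

Definition frac_eq (a b : frac) : Prop :=
  Permutation (pmul (fnum a) (fden b)) (pmul (fnum b) (fden a)).

Definition fconst (c : P) : fracsf := Frac [:: (c, [ffun => 0])] [:: mone].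
Definition fgen (i : 'I_n) : fracsf := Frac [:: (sf_one P, delta i)] [:: mone].
Definition fmono (e : {ffun 'I_n -> int}) : fracsf := Frac [:: (sf_one P, e)] [:: mone].

Section Eval.
Variables (Q : sfops) (phi : P -> Q) (q : 'I_n -> Q).
Definition eval_mono (m : mono) : Q :=
  sf_mul Q (phi m.1) (sf_prod (fun i => sf_expz (q i) (m.2 i))).
Definition eval_poly (p : npoly) : Q :=
  match p with
  | [::] => sf_one Q (* never used: polynomials are nonzero *)
  | a :: p' => foldr (fun m acc => sf_add Q (eval_mono m) acc) (eval_mono a) p'
  end.
Definition eval_frac (a : frac) : Q := sf_div (eval_poly (fnum a)) (eval_poly (fden a)).
End Eval.
End Frac.

Definition Qsf (n : nat) : sfops := fracsf unitsf n.
Definition sf_image (n : nat) (Q : sfops) (f : Qsf n) (q : 'I_n -> Q) : Q :=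
  eval_frac (fun _ => sf_one Q) q f.

Definition Ypat (n : nat) (B0 : 'M[int]_n) (v : seq 'I_n) : 'I_n -> Qsf n :=
  ypat B0 (fun i => fgen unitsf i) v.

(* c_{j;v}: Y_{j;v}^{Trop(y)}(y_1..y_n) = prod_i y_i^{c_{ij;v}} *)
Definition cvec (n : nat) (B0 : 'M[int]_n) (v : seq 'I_n) (j : 'I_n)
    : {ffun 'I_n -> int} :=
  sf_image (Q := trop n) (Ypat B0 v j) (fun i => delta i).

(* F-polynomials via principal coefficients                           *)
(* Ambient field: Q P(x_1..x_n) with P = Trop(z_1..z_n); initial seed   *)
(* ((x_1..x_n),(z_1..z_n),B0).                                          *)
Definition XFZ (n : nat) (B0 : 'M[int]_n) (v : seq 'I_n) : 'I_n -> fracsf (trop n) n :=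
  cpat (@fconst (trop n) n) B0 (fun i => delta i) (fun i => fgen (trop n) i) v.

(* specialization x_1 = ... = x_n = 1, landing in Q_sf(z_1..z_n) *)
Definition spec_x1 (n : nat) (X : fracsf (trop n) n) : Qsf n :=
  Frac [seq ((tt : unitsf), m.1) | m <- fnum X] [seq ((tt : unitsf), m.1) | m <- fden X].

Definition Fpoly (n : nat) (B0 : 'M[int]_n) (v : seq 'I_n) (j : 'I_n) : Qsf n :=
  spec_x1 (XFZ B0 v j).

Definition Ytil (P : sfops) (n : nat) (B0 : 'M[int]_n) (p : 'I_n -> P)
    (v : seq 'I_n) : 'I_n -> fracsf P n :=
  ycpat (@fconst P n) B0 p (fun i => fgen P i) v.

(* Main.v *)
Require Import Defs.
From HB Require Import structures.
From mathcomp Require Import all_boot all_order all_algebra.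
From mathcomp Require Import boolp generic_quotient.
From Stdlib Require Import Permutation Setoid Morphisms Ring.
Import Order.TTheory GRing.Theory Num.Theory.
Local Open Scope ring_scope.
Set Implicit Arguments.
Unset Strict Implicit.
Unset Printing Implicit Defensive.

(* In an honest semifield Q, the identity Y_j(q) = q^{c_j} prod_i F_i(q)^{b_ij}
   propagates along mutations.  Indeed the c-vectors are the Y-pattern of
   Trop(z_1..z_n), hence the coefficients of the principal-coefficient cluster
   pattern, and evaluating that pattern at x_i = 1, z_i = q_i gives F_i(q); the
   sum 1 + Y_k^{-+1} is then F'_k F_k divided by one of the two terms of the
   exchange relation.  On the other hand Ytilde_j = Y_j(p y) / Y_j(p), again by
   induction along mutations, and dividing the identity in S at p y by the one in
   P at p gives the theorem.

   That equality of ratios is an equivalence, so that S is a quotient semifield,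
   rests on cancellation in N[G] for the torsion-free group G = P x Z^n.  Finitely
   many elements of G can be ordered compatibly with the group law, and then two
   multisets c + a = c + b have least elements min c + min a = min c + min b. *)

Lemma Permutation_perm_eq (T : eqType) (s t : seq T) :
  Permutation s t <-> perm_eq s t.
Proof.
split.
  elim=> {s t} [|x s t _|x y s|s t u _ st _] //; rewrite ?perm_cons //.
    by apply/permP => P /=; rewrite addnCA.
  exact: seq.perm_trans.
elim: s t => [|x s IHs] t; first by rewrite perm_sym => /perm_nilP ->.
rewrite perm_sym => /perm_consP [i [u [ut us]]].
have /IHs su : perm_eq s u by rewrite perm_sym.
apply: perm_trans (perm_skip x su) _.
rewrite -ut /rot -{3}(cat_take_drop i t); exact: Permutation_app_comm.
Qed.

(** * Finite multisets in an abelian group G: the semiring N[G] and cancellation *)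

Section GroupSemiring.
Variable G : zmodType.
Implicit Types (p q r : seq G) (f : G -> nat).

Definition mulp p q : seq G := [seq a + b | a <- p, b <- q].

(** Turns identities between products of multisets into manipulations of iterated sums; for the
    converse direction, indicator functions are enough. *)
Lemma perm_eq_sumP p q :
  perm_eq p q <-> forall f, (\sum_(x <- p) f x = \sum_(x <- q) f x)%N.
Proof.
split=> [pq f|pq]; first exact: perm_big.
by apply/permP => P; rewrite -!sum1_count big_mkcond [RHS]big_mkcond.
Qed.

Lemma big_mulp p q f :
  (\sum_(x <- mulp p q) f x = \sum_(a <- p) \sum_(b <- q) f (a + b)%R)%N.
Proof. by rewrite big_allpairs_dep. Qed.

Lemma perm_mulp p p' q q' :
  perm_eq p p' -> perm_eq q q' -> perm_eq (mulp p q) (mulp p' q').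
Proof.
move=> /perm_eq_sumP pp /perm_eq_sumP qq; apply/perm_eq_sumP => f.
by rewrite !big_mulp pp; apply: eq_bigr => a _; apply: qq.
Qed.

Lemma seq_semiring : semi_ring_theory [::] [:: 0 : G] cat mulp
  (fun p q => perm_eq p q).
Proof.
split=> [p|p q|p q r|p|p|p q|p q r|p q r] //.
- by rewrite perm_catC.
- by rewrite catA.
- apply/perm_eq_sumP => f; rewrite !big_mulp big_seq1.
  by apply: eq_bigr => a _; rewrite add0r.
- apply/perm_eq_sumP => f; rewrite !big_mulp exchange_big /=.
  by apply: eq_bigr => a _; apply: eq_bigr => b _; rewrite addrC.
- apply/perm_eq_sumP => f; rewrite !big_mulp; apply: eq_bigr => a _.
  rewrite !big_mulp; apply: eq_bigr => b _.
  by apply: eq_bigr => c _; rewrite addrA.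
- by apply/perm_eq_sumP => f; rewrite big_cat /= !big_mulp big_cat.
Qed.

Lemma size_mulp p q : size (mulp p q) = (size p * size q)%N.
Proof. exact: size_allpairs. Qed.

Hypothesis G_torsion_free : forall (x : G) m, x *+ m.+1 = 0 -> x = 0.

(* A finite substitute for a compatible total order on [G]. *)
Lemma finite_cone (D : seq G) : exists pos : G -> Prop,
  [/\ forall x y, pos x -> pos y -> pos (x + y), ~ pos 0 &
      forall d, d \in D -> [\/ d = 0, pos d | pos (- d)]].
Proof.
elim: D => [|d D [pos [posD pos0 posP]]]; first by exists (fun=> False); split.
have posM x m : pos x -> pos (x *+ m.+1).
  move=> px; elim: m => [|m IHm]; first by rewrite mulr1n.
  by rewrite mulrS; apply: posD.
have [->|d0] := eqVneq d 0.
  by exists pos; split=> // x; rewrite inE => /predU1P[->|/posP //]; constructor 1.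
have [[m pm]|npos] := pselect (exists m, pos ((- d) *+ m.+1)).
  (* Some multiple of -d is positive: saturate the cone, so that x is positive as soon as one of its
     multiples is. This makes -d positive. *)
  exists (fun x => exists m, pos (x *+ m.+1)); split.
  (* The witness is (i+1)(j+1) - 1, because [m] stands for the multiple m+1. *)
  - move=> x y [i px] [j py]; exists (i * j.+1 + j)%N.
    have -> : (i * j.+1 + j).+1 = (i.+1 * j.+1)%N by rewrite mulSn addnC -addSn.
    rewrite mulrnDl {2}mulnC !mulrnA.
    by apply: posD; apply: posM.
  - by case=> i; rewrite mul0rn.
  - move=> x; rewrite inE => /predU1P[->|/posP []].
    + by constructor 3; exists m.
    + by constructor 1.
    + by constructor 2; exists 0%N.
    + by constructor 3; exists 0%N.
have npos' m : ~ pos (- d *+ m.+1) by move=> pm; apply: npos; exists m.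
(* Otherwise d itself is adjoined: the new cone is [pos] + N d together with the positive multiples
   of d. It misses 0 because no multiple of -d is positive and G is torsion-free. *)
exists (fun x => exists m, pos (x - d *+ m) \/ x = d *+ m.+1); split.
- move=> x y [i px] [j py].
  case: px => [px|->]; case: py => [py|->].
  + by exists (i + j)%N; left; rewrite mulrnDr opprD addrACA; apply: posD.
  + by exists (i + j.+1)%N; left; rewrite mulrnDr opprD addrACA subrr addr0.
  + by exists (i.+1 + j)%N; left; rewrite mulrnDr opprD addrACA subrr add0r.
  + by exists (i.+1 + j)%N; right; rewrite -mulrnDr addnS.
- case=> -[|m] [].
  + by rewrite mulr0n subr0.
  + by rewrite mulr1n => d00; rewrite -d00 eqxx in d0.
  + by rewrite sub0r -mulNrn; apply: npos'.
  + by move/esym/G_torsion_free => d00; rewrite d00 eqxx in d0.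
- move=> x; rewrite inE => /predU1P[->|/posP []].
  + by constructor 2; exists 0%N; right.
  + by constructor 1.
  + by constructor 2; exists 0%N; left; rewrite mulr0n subr0.
  + by constructor 3; exists 0%N; left; rewrite mulr0n subr0.
Qed.

(** Induction on the size of p: the least elements of p and q agree, and removing them preserves the
    hypothesis. *)
Lemma mulp_cancel c p q :
  c != [::] -> perm_eq (mulp c p) (mulp c q) -> perm_eq p q.
Proof.
move=> c0.
(* The order [le] has to be total only on the elements that occur. *)
pose E := c ++ p ++ q.
have [pos [posD pos0 posP]] := finite_cone [seq y - x | x <- E, y <- E].
have total x y : x \in E -> y \in E -> [\/ y - x = 0, pos (y - x) | pos (x - y)].
  by move=> xE yE; rewrite -(opprB y x); apply: posP; apply: allpairs_f.
pose le x y := y - x = 0 \/ pos (y - x).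
have leD x y x' y' : le x y -> le x' y' -> le (x + x') (y + y').
  rewrite /le opprD addrACA => -[->|px] [->|py]; rewrite ?add0r ?addr0; 
    by [left | right | right; apply: posD].
have le_trans x y z : le x y -> le y z -> le x z.
  move=> xy yz; have := leD _ _ _ _ xy yz.
  by rewrite /le (addrC y) opprD addrACA subrr addr0.
have le_anti x y : le x y -> le y x -> x = y.
  rewrite /le => -[/subr0_eq -> //|pxy] [/subr0_eq //|pyx].
  by case: pos0; have := posD _ _ pxy pyx; rewrite subrKA subrr.
have minimum (s : seq G) : {subset s <= E} -> s != [::] ->
    exists2 x, x \in s & forall y, y \in s -> le x y.
  elim: s => [|x s IHs] // sE _; have [->|s0] := eqVneq s [::].
    by exists x; rewrite ?mem_head // => y; rewrite inE => /eqP ->; left; rewrite subrr.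
  have [y ys ymin] : exists2 x, x \in s & forall y, y \in s -> le x y.
    by apply: IHs s0 => z zs; apply: sE; rewrite inE zs orbT.
  have lexx z : le z z by left; rewrite subrr.
  have cmp : le x y \/ le y x.
    case: (total x y); rewrite ?sE ?mem_head ?inE ?ys ?orbT //.
    - by left; left.
    - by left; right.
    - by right; right.
  case: cmp => [xy|yx].
    exists x; first exact: mem_head.
    by move=> z; rewrite inE => /predU1P[->//|/ymin]; apply: le_trans.
  exists y; first by rewrite inE ys orbT.
  by move=> z; rewrite inE => /predU1P[->//|/ymin].
have [c1 c1c c1min] : exists2 x, x \in c & forall y, y \in c -> le x y.
  by apply: minimum c0 => x xc; rewrite mem_cat xc.
have pE : {subset p <= E} by move=> x xp; rewrite !mem_cat xp orbT.
have qE : {subset q <= E} by move=> x xq; rewrite !mem_cat xq !orbT.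
(* [E] becomes opaque, so the order stays fixed while the induction replaces p and q by smaller
   lists inside [E]. *)
clearbody E.
(* Write c1 + a = c2 + b2 with c2 in c and b2 in t; since c1 <= c2 and b <= b2, this forces b <=
   a. *)
have dom (s t : seq G) a : {subset t <= E} -> perm_eq (mulp c s) (mulp c t) -> a \in s ->
    forall b, (forall z, z \in t -> le b z) -> le b a.
  move=> tE st as_ b bmin.
  have : c1 + a \in mulp c t by rewrite -(perm_mem st); apply: allpairs_f.
  case/allpairsP=> -[c2 b2] /= [/c1min cc /bmin bb ca].
  have := leD _ _ _ _ cc bb; rewrite -ca /le opprD addrACA subrr add0r.
  by [].
elim: {p}(size p) {-2}p (erefl (size p)) q pE qE => [|m IHm] p sp q pE qE pq.
  move/perm_size: (pq); rewrite !size_mulp sp muln0 => /esym/eqP.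
  rewrite muln_eq0 size_eq0; case/orP => [/eqP cnil|]; first by rewrite cnil in c1c.
  by rewrite size_eq0 (size0nil sp) => /eqP ->.
have p0 : p != [::] by rewrite -size_eq0 sp.
have q0 : q != [::].
  apply: contraTneq c1c => q0; move/perm_size: (pq); rewrite !size_mulp q0 sp muln0.
  by move/eqP; rewrite muln_eq0 orbF size_eq0 => /eqP ->.
have [a ap amin] := minimum p pE p0; have [b bq bmin] := minimum q qE q0.
have ab : a = b.
  apply: le_anti; last exact: (dom p q).
  by apply: (dom q p) => //; rewrite perm_sym.
rewrite -{b}ab in bq bmin.
have pp := perm_to_rem ap; have qq := perm_to_rem bq.
rewrite (permPl pp) (permPr qq) perm_cons.
apply: IHm.
- by rewrite size_rem // sp.
- by move=> x /mem_rem/pE.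
- by move=> x /mem_rem/qE.
(* Removing the common element a subtracts the same quantity from both sides, the sum of f (x + a)
   over x in c. *)
apply/perm_eq_sumP => f.
have /perm_eq_sumP/(_ f) := pq; rewrite !big_mulp.
rewrite (eq_bigr _ (fun x _ => perm_big _ pp)) (eq_bigr _ (fun x _ => perm_big _ qq)) /=.
under eq_bigr do rewrite big_cons.
under [in RHS]eq_bigr do rewrite big_cons.
by rewrite !big_split /= => /addnI.
Qed.

End GroupSemiring.

(** * Semifields and their multiplicative groups *)

Record semifield := Semifield { sf_ops :> sfops; sf_axioms : is_semifield sf_ops }.

(* The multiplicative group of a semifield, written additively so as to use the
   library of Z-modules: [x + y], [- x], [x *~ k] mean [x y], [x^-1], [x^k]. *)
Definition mulgroup (Q : semifield) : Type := sf_car Q.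

HB.instance Definition _ (Q : semifield) := gen_eqMixin (mulgroup Q).
HB.instance Definition _ (Q : semifield) := gen_choiceMixin (mulgroup Q).

Section MulgroupZmodule.
Variable Q : semifield.

Fact mulgroup_mulA : associative (sf_mul Q : mulgroup Q -> mulgroup Q -> mulgroup Q).
Proof. by case: (sf_axioms Q) => _ [_ [? _]]. Qed.

Fact mulgroup_mulC : commutative (sf_mul Q : mulgroup Q -> mulgroup Q -> mulgroup Q).
Proof. by case: (sf_axioms Q) => _ [_ [_ [? _]]]. Qed.

Fact mulgroup_mul1 :
  left_id (sf_one Q) (sf_mul Q : mulgroup Q -> mulgroup Q -> mulgroup Q).
Proof. by case: (sf_axioms Q) => _ [_ [_ [_ [? _]]]]. Qed.

Fact mulgroup_mulV :
  left_inverse (sf_one Q) (sf_inv Q) (sf_mul Q : mulgroup Q -> mulgroup Q -> mulgroup Q).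
Proof. by case: (sf_axioms Q) => _ [_ [_ [_ [_ [? _]]]]]. Qed.

End MulgroupZmodule.

HB.instance Definition _ (Q : semifield) := GRing.isZmodule.Build (mulgroup Q)
  (@mulgroup_mulA Q) (@mulgroup_mulC Q) (@mulgroup_mul1 Q) (@mulgroup_mulV Q).

Section SemifieldTheory.
Variable Q : semifield.
Implicit Types x y z : mulgroup Q.

Definition oplus x y : mulgroup Q := sf_add Q x y.

Lemma oplusA : associative oplus.
Proof. by case: (sf_axioms Q). Qed.

Lemma oplusC : commutative oplus.
Proof. by case: (sf_axioms Q) => _ []. Qed.

Lemma oplusDl x y z : oplus x y + z = oplus (x + z) (y + z).
Proof. by case: (sf_axioms Q) => _ [_ [_ [_ [_ [_]]]]]; apply. Qed.

Lemma oplusDr x y z : z + oplus x y = oplus (z + x) (z + y).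
Proof. by rewrite ![z + _]addrC oplusDl. Qed.

Lemma sf_expnE (x : Q) m : sf_expn x m = (x : mulgroup Q) *+ m.
Proof. by elim: m => [|m /= ->]; rewrite ?mulrS. Qed.

Lemma sf_expzE (x : Q) k : sf_expz x k = (x : mulgroup Q) *~ k.
Proof. by case: k => m; rewrite /sf_expz sf_expnE. Qed.

Lemma sf_prodE n (f : 'I_n -> Q) : sf_prod f = \sum_i (f i : mulgroup Q).
Proof.
rewrite /sf_prod -big_enum /=.
by elim: (enum _) => [|i s IHs]; rewrite ?big_nil //= big_cons -IHs.
Qed.

Lemma sf_plusE x : sf_plus x = x - oplus x 0.
Proof. by []. Qed.

Lemma sf_minusE x : sf_minus x = - oplus x 0.
Proof. by rewrite -[LHS]/(0 - oplus x 0 : mulgroup Q) add0r. Qed.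

Lemma sf_plusBminus x : (sf_plus x : mulgroup Q) - (sf_minus x : mulgroup Q) = x.
Proof. by rewrite sf_plusE sf_minusE opprK subrK. Qed.

(** With [oplus0N], this expresses the factors 1 ⊕ x and 1 ⊕ x^-1 of Y-mutation through x^- and x^+,
    the coefficients of the exchange relation. *)
Lemma oplus0 x : oplus 0 x = - (sf_minus x : mulgroup Q).
Proof. by rewrite sf_minusE opprK oplusC. Qed.

Lemma oplus0N x : oplus 0 (- x) = - (sf_plus x : mulgroup Q).
Proof. by rewrite sf_plusE opprB oplusDl subrr add0r. Qed.

(* If [x] has order dividing [m.+1], then [1 + x + ... + x^m] is fixed by [x]. *)
Lemma mulgroup_torsion_free x m : x *+ m.+1 = 0 -> x = 0.
Proof.
pose s := fix s k := if k is k'.+1 then oplus (s k') (x *+ k) else (0 : mulgroup Q).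
(* In multiplicative notation both sides are 1 ⊕ x ⊕ ... ⊕ x^(k+1). *)
have sE k : oplus (x + s k) 0 = oplus (s k) (x *+ k.+1).
  elim: k => [|k IHk] /=; first by rewrite addr0 mulr1n oplusC.
  by rewrite oplusDr -mulrS -oplusA (oplusC _ 0) oplusA IHk.
case: m => [|m] xm; first by rewrite mulr1n in xm.
have xs : x + s m.+1 = s m.+1.
  by rewrite /= oplusDr -mulrS xm oplusC -sE oplusC.
by apply: (addIr (s m.+1)); rewrite add0r.
Qed.

End SemifieldTheory.

Fact trop_semifield n : is_semifield (trop n).
Proof.
split=> [x y z|]; first by apply/ffunP => i; rewrite !ffunE minA.
split=> [x y|]; first by apply/ffunP => i; rewrite !ffunE minC.
split=> [x y z|]; first by apply/ffunP => i; rewrite !ffunE addrA.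
split=> [x y|]; first by apply/ffunP => i; rewrite !ffunE addrC.
split=> [x|]; first by apply/ffunP => i; rewrite !ffunE add0r.
split=> [x|x y z]; first by apply/ffunP => i; rewrite !ffunE addNr.
by apply/ffunP => i; rewrite !ffunE addr_minl.
Qed.

Definition tropS n := Semifield (trop_semifield n).

(** * Matrix mutation *)

Section MatrixMutation.
Variables (n : nat) (k : 'I_n) (B : 'M[int]_n).

Lemma skew_symmetrizable_diag i : skew_symmetrizable B -> B i i = 0.
Proof.
case=> d [d0 dB]; apply/eqP; have := dB i i.
move/eqP; rewrite -subr_eq0 opprK -mulr2n mulrn_eq0 mulf_eq0 /=.
by rewrite eqz_nat eqn0Ngt d0.
Qed.

(** The same symmetrizer works. After scaling, both correction terms contain the factor max(0, - d_k
    b_ki b_kj); when it is nonzero, b_ki and b_kj have opposite signs. *)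
Lemma mutmx_skew_symmetrizable : skew_symmetrizable B -> skew_symmetrizable (mutmx k B).
Proof.
case=> d [d0 dB]; exists d; split=> // i j; rewrite !mxE orbC.
case: ifP => _; first by rewrite !mulrN dB.
have sgzM i' (x : int) : sgz ((d i')%:Z * x) = sgz x.
  by rewrite sgzM gtr0_sgz ?mul1r // ltz_nat.
have sgB i' j' : sgz (B i' j') = - sgz (B j' i').
  by rewrite -(sgzM i') dB sgzN sgzM.
have maxM i' x : (d i')%:Z * Num.max 0 x = Num.max 0 ((d i')%:Z * x).
  by rewrite maxr_pMr ?mulr0.
rewrite !mulrDr opprD -dB; congr (_ + _).
rewrite !(mulrCA _ (sgz _)) !maxM !mulrA (dB i k) (dB j k) (sgB i k) (sgB j k).
rewrite !mulNr opprK -!mulrA (mulrC (B k j)).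
case: (lerP 0 (- _)) => [M|_]; last by rewrite !mulr0 oppr0.
have : B k i * B k j <= 0.
  by move: M; rewrite oppr_ge0 pmulr_rle0 // ltz_nat.
case: (sgzP (B k i)) => Bi; case: (sgzP (B k j)) => Bj;
  rewrite ?Bi ?Bj ?mulr0 ?mul0r ?oppr0 ?mul1r ?mulN1r ?opprK ?mulr0 ?oppr0 //.
  by rewrite leNgt mulr_gt0.
by rewrite leNgt nmulr_rgt0 ?Bj.
Qed.

End MatrixMutation.

(** Once the sign of b_kj is fixed, the correction term of matrix mutation is linear in b_kj, which
    is the form [sum_mutmx] asks for. *)
Lemma sgz_max_pos (x b : int) : 0 < b -> sgz x * Num.max 0 (x * b) = Num.max 0 x * b.
Proof.
move=> b0; rewrite -{1}(mul0r b) -maxr_pMl ?ltW // mulrA; congr (_ * _).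
by case: (ltrgtP x 0) => [x0|x0|->]; rewrite ?mulr0 // gtr0_sgz // mul1r.
Qed.

Lemma sgz_max_neg (x b : int) : b < 0 -> sgz x * Num.max 0 (x * b) = Num.max 0 (- x) * b.
Proof.
rewrite -oppr_gt0 => /(sgz_max_pos (- x)).
by rewrite mulrNN sgzN mulNr mulrN => /oppr_inj.
Qed.

Section Exponents.
Variables (V : zmodType) (n : nat) (k : 'I_n) (B : 'M[int]_n) (f : 'I_n -> V).

(* [u k] is arbitrary: it stands for the mutated variable. *)
Lemma sum_mutmx (u : 'I_n -> V) (M : 'I_n -> int) (j : 'I_n) :
  j != k -> (forall i, i != k -> u i = f i) -> M k = 0 ->
  (forall i, sgz (B i k) * Num.max 0 (B i k * B k j) = M i * B k j) ->
  \sum_i u i *~ mutmx k B i j =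
  \sum_i f i *~ B i j - (u k + f k - \sum_i f i *~ M i) *~ B k j.
Proof.
move=> jk uf Mk ME; rewrite (bigD1 k) //= [X in X - _](bigD1 k) //=.
rewrite [X in _ - (_ - X) *~ _](bigD1 k) //= Mk mulr0z add0r.
rewrite mxE eqxx /= mulrNz mulrzBl mulrzDl mulrz_suml.
rewrite (eq_bigr (fun i => f i *~ B i j + f i *~ M i *~ B k j)); last first.
  by move=> i ik; rewrite uf // mxE (negPf ik) (negPf jk) /= ME mulrzDr mulrzA.
rewrite big_split /= opprB opprD !addrA.
by rewrite [RHS]addrC !addrA addNr add0r [RHS]addrC addrA.
Qed.
End Exponents.

Lemma tropMzE n (c : mulgroup (tropS n)) k i : (c *~ k : trop n) i = c i * k.
Proof.
have cn m : (c *+ m : trop n) i = c i *+ m.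
  by elim: m => [|m IHm]; rewrite ?mulr0n ?mulrS !ffunE ?IHm.
by case: k => m; rewrite -mulrzz; [exact: cn | rewrite [LHS]ffunE cn].
Qed.

(** * The separation formula in a semifield *)

Section Separation.
Variables (Q : semifield) (n : nat) (q : 'I_n -> Q).

(* The monomial [q^c]. It is a morphism of groups, not of semifields. *)
Definition trop_eval (c : trop n) : mulgroup Q := \sum_i (q i : mulgroup Q) *~ c i.

Lemma trop_evalD (c d : mulgroup (tropS n)) :
  trop_eval (c + d) = trop_eval c + trop_eval d.
Proof.
by rewrite /trop_eval -big_split; apply: eq_bigr => i _ /=; rewrite ffunE mulrzDr.
Qed.

Lemma trop_evalMz (c : mulgroup (tropS n)) k : trop_eval (c *~ k) = trop_eval c *~ k.
Proof.
rewrite /trop_eval mulrz_suml; apply: eq_bigr => i _.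
by rewrite -mulrzA tropMzE.
Qed.

Lemma trop_evalN (c : mulgroup (tropS n)) : trop_eval (- c) = - trop_eval c.
Proof. by rewrite -mulrN1z trop_evalMz mulrN1z. Qed.

Lemma trop_eval_delta i : trop_eval (delta i) = q i.
Proof.
rewrite /trop_eval (bigD1 i) //= big1 => [|j /negPf ji].
  by rewrite addr0 ffunE eqxx.
by rewrite ffunE ji.
Qed.

(** Patterns recurse on the first edge of the path, so the initial seed changes during the
    induction. Hence y, c and f are arbitrary, subject to the identity to be propagated, and a
    single mutation has to be checked. *)
Lemma ypat_separation (B : 'M[int]_n) (y : 'I_n -> Q) (c : 'I_n -> trop n)
    (f : 'I_n -> Q) (v : seq 'I_n) :
  skew_symmetrizable B ->
  (forall j, y j = trop_eval (c j) + \sum_i (f i : mulgroup Q) *~ B i j) ->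
  forall j, ypat B y v j = trop_eval (ypat B c v j) +
     \sum_i (cpat trop_eval B c f v i : mulgroup Q) *~ Bpat B v i j.
Proof.
elim: v B y c f => [|k v IHv] B y c f //= Bskew yE.
apply: IHv => [|j]; first exact: mutmx_skew_symmetrizable.
have Bkk := skew_symmetrizable_diag k Bskew.
rewrite /ymut; have [->|jk] := eqVneq j k.
  (* At j = k both sides are inverted: column k changes sign, and f_k, the only f that changes, has
     exponent b_kk = 0. *)
  rewrite -[sf_inv _ _]/(- (y k : mulgroup Q)) yE opprD.
  rewrite -[sf_inv _ _]/(- (c k : mulgroup (tropS n))) trop_evalN.
  congr (_ + _ : mulgroup Q); rewrite -sumrN; apply: eq_bigr => i _.
  rewrite mxE eqxx orbT mulrNz /cmut; have [->|//] := eqVneq i k.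
  by rewrite Bkk !mulr0z.
(* A and C are the cluster monomials of the two terms of the exchange relation at k; y_k is the term
   with C divided by the term with A. *)
pose A := \sum_i (f i : mulgroup Q) *~ Num.max 0 (- B i k).
pose C := \sum_i (f i : mulgroup Q) *~ Num.max 0 (B i k).
pose cm := sf_minus (c k) : mulgroup (tropS n).
pose cp := sf_plus (c k) : mulgroup (tropS n).
have maxD (x : int) : x = Num.max 0 x - Num.max 0 (- x).
  case: (leP 0 x) => x0; first by rewrite max_l ?oppr_le0 // subr0.
  by rewrite max_r ?oppr_ge0 ?ltW // sub0r opprK.
have ykE : (y k : mulgroup Q) = (trop_eval cp + C) - (trop_eval cm + A).
  rewrite yE -(@sf_plusBminus (tropS n) (c k)) trop_evalD trop_evalN opprD addrACA.
  congr (_ + _ : mulgroup Q); rewrite -sumrB; apply: eq_bigr => i _.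
  by rewrite {1}(maxD (B i k)) mulrzBr.
pose u := cmut trop_eval k B c f : 'I_n -> mulgroup Q.
have uk : u k + f k = oplus (trop_eval cm + A) (trop_eval cp + C).
  rewrite /u /cmut eqxx -[sf_div _ _]/(oplus (_ + _) (_ + _) - (f k : mulgroup Q)) subrK !sf_prodE.
  congr (oplus (_ + _) (_ + _)); apply: eq_bigr => i _.
    case: (ltP (B i k) 0) => Bik; last by rewrite max_l ?oppr_le0.
    by rewrite max_r ?oppr_ge0 ?ltW // sf_expzE.
  by case: (ltP 0 (B i k)) => // _; rewrite sf_expzE.
have uf i : i != k -> u i = f i by rewrite /u /cmut => /negPf ->.

(* The sum of the two terms is f'_k f_k, with f'_k = [u k]; dividing it by either term gives 1 ⊕ y_k
   or 1 ⊕ y_k^-1. *)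
have oplus0y : oplus 0 (y k) = u k + f k - (trop_eval cm + A).
  by rewrite uk oplusDl subrr -ykE.
have oplus0Ny : oplus 0 (- (y k : mulgroup Q)) = u k + f k - (trop_eval cp + C).
  by rewrite uk oplusDl subrr ykE opprB oplusC.
rewrite -[LHS]/((y j : mulgroup Q) +
  sf_expz (oplus 0 (sf_expz (y k) (- sgz (B k j)))) (- B k j)).
rewrite -[X in trop_eval X]/((c j : mulgroup (tropS n)) +
  sf_expz (P := tropS n) (oplus (Q := tropS n) 0
    (sf_expz (P := tropS n) (c k) (- sgz (B k j)))) (- B k j)).
rewrite !sf_expzE trop_evalD trop_evalMz yE -!addrA; congr (_ + _ : mulgroup Q).
have regroup (a x t m : mulgroup Q) (b : int) :
  a + (x - (t + m)) *~ - b = (- t) *~ - b + (a - (x - m) *~ b).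
  have -> : x - (t + m) = (x - m) - t by rewrite opprD addrA addrAC.
  by rewrite !mulrNz mulNrz opprK mulrzBl opprB addrCA.
(* The sign of b_kj selects the term to divide by: the mutation of c accounts for its coefficient,
   and [M] for its cluster monomial. *)
case: (sgzP (B k j)) => b.
- rewrite (sum_mutmx jk uf (M := fun=> 0)) // ?b ?oppr0 ?mulr0z ?subr0 ?addr0 ?add0r //.
  by move=> i; rewrite ?b !mulr0.
- rewrite (sum_mutmx jk uf (M := fun i => Num.max 0 (B i k))) ?Bkk //; last first.
    by move=> i; apply: sgz_max_pos.
  rewrite !mulrN1z oplus0Ny oplus0N trop_evalN; exact: regroup.
- rewrite (sum_mutmx jk uf (M := fun i => Num.max 0 (- B i k))) ?Bkk ?oppr0 //; last first.
    by move=> i; apply: sgz_max_neg.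
  rewrite opprK !mulr1z oplus0y oplus0 trop_evalN; exact: regroup.
Qed.

End Separation.

(** * Y-patterns with coefficients as ratios of Y-patterns *)

Section GroupMorphism.
Variables (P Q : semifield) (iota : P -> mulgroup Q).
(** The embedding of P into S is multiplicative but not additive: a sum in P is not the sum of the
    corresponding constants. *)
Hypothesis iotaD : forall x y : mulgroup P, iota (x + y) = iota x + iota y.

Lemma mulgroup_morph0 : iota (0 : mulgroup P) = 0.
Proof. by apply: (addIr (iota (0 : mulgroup P))); rewrite -iotaD !add0r. Qed.

Lemma mulgroup_morphN (x : mulgroup P) : iota (- x) = - iota x.
Proof. by apply: (addIr (iota x)); rewrite -iotaD !addNr mulgroup_morph0. Qed.

Lemma mulgroup_morphMz (x : mulgroup P) k : iota (x *~ k) = iota x *~ k.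
Proof.
have iotaMn m : iota (x *+ m) = iota x *+ m.
  by elim: m => [|m IHm]; rewrite ?mulr0n ?mulgroup_morph0 // !mulrS iotaD IHm.
by case: k => m; rewrite -?pmulrn ?NegzE ?mulrNz ?mulgroup_morphN -?pmulrn iotaMn.
Qed.

Lemma mulgroup_morph_sum n (x : 'I_n -> mulgroup P) : iota (\sum_i x i) = \sum_i iota (x i).
Proof. exact: (big_morph iota iotaD mulgroup_morph0). Qed.

Lemma mulgroup_morph_trop_eval n (q : 'I_n -> mulgroup P) c :
  iota (trop_eval q c) = trop_eval (fun i => iota (q i)) c.
Proof. by rewrite mulgroup_morph_sum; apply: eq_bigr => i _; rewrite mulgroup_morphMz. Qed.

(** With b = b_kj and e = sgn b, multiplying p^[[b]] + p^[[-b]] y^-e by 1 ⊕ p^-e gives 1 + (p y)^-e.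
    So multiplication by the Y-pattern at p turns mutation with coefficients into ordinary
    Y-mutation. *)
Lemma ycpat_ypat n (B : 'M[int]_n) (p : 'I_n -> mulgroup P) (y : 'I_n -> mulgroup Q) v j :
  iota (ypat B p v j) + ycpat iota B p y v j =
  ypat B (fun i => iota (p i) + y i : Q) v j.
Proof.
elim: v B p y => [|k v IHv] B p y //=.
rewrite IHv; congr (ypat _ _ v j); apply: funext => {IHv j} j.
rewrite /ymut /ycmut; have [_|jk] := eqVneq j k; first by rewrite mulgroup_morphN -opprD.
rewrite -[LHS]/(iota (p j + sf_expz (oplus 0 (sf_expz (p k) (- sgz (B k j)))) (- B k j))
  + (y j + sf_expz (oplus (iota (sf_bracket (p k) (B k j)))
     (iota (sf_bracket (p k) (- B k j)) + sf_expz (y k) (- sgz (B k j)))) (- B k j))).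
rewrite -[RHS]/((iota (p j) + y j)
  + sf_expz (oplus 0 (sf_expz (iota (p k) + y k) (- sgz (B k j)))) (- B k j)).
rewrite !sf_expzE iotaD mulgroup_morphMz addrACA -mulrzDl; congr (_ + _ : mulgroup Q).
rewrite /sf_bracket oppr_lt0 oppr_eq0.
case: (sgzP (B k j)) => b; first by rewrite ?b ?oppr0 ?mulr0z.
- rewrite !mulrN1z oplus0N mulgroup_morphN oplusDr addNr addrA opprD; congr (oplus 0 (_ + _) *~ _).
  by rewrite -!mulgroup_morphN -iotaD addrC -opprB sf_plusBminus.
- rewrite opprK !mulr1z oplus0 mulgroup_morphN oplusDr addNr addrA; congr (oplus 0 (_ + _) *~ _).
  by rewrite -mulgroup_morphN -iotaD addrC sf_plusBminus.
Qed.

End GroupMorphism.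

(** * Maps compatible with the semifield operations *)

(** Raw ratios satisfy the semifield axioms only up to [frac_eq], and only when they are well
    formed. Thus A is a bare [sfops], and [good] singles out the elements on which h is a
    morphism. *)
Record sf_hom (A Q : sfops) (good : A -> Prop) (h : A -> Q) : Prop := SfHom {
  hom_add : forall x y, good x -> good y ->
    good (sf_add A x y) /\ h (sf_add A x y) = sf_add Q (h x) (h y);
  hom_mul : forall x y, good x -> good y ->
    good (sf_mul A x y) /\ h (sf_mul A x y) = sf_mul Q (h x) (h y);
  hom_one : good (sf_one A) /\ h (sf_one A) = sf_one Q;
  hom_inv : forall x, good x -> good (sf_inv A x) /\ h (sf_inv A x) = sf_inv Q (h x) }.

Section Hom.
Variables (A Q : sfops) (good : A -> Prop) (h : A -> Q).
Hypothesis hh : sf_hom good h.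

Lemma hom_expz x k : good x -> good (sf_expz x k) /\ h (sf_expz x k) = sf_expz (h x) k.
Proof.
move=> gx; have En m : good (sf_expn x m) /\ h (sf_expn x m) = sf_expn (h x) m.
  elim: m => [|m [gm IHm]] /=; first exact: hom_one hh.
  by have [? ->] := hom_mul hh gx gm; rewrite IHm.
case: k => m; first exact: En.
by rewrite /sf_expz; have [gm Em] := En m.+1; have [? ->] := hom_inv hh gm; rewrite Em.
Qed.

Lemma hom_prod n (f : 'I_n -> A) : (forall i, good (f i)) ->
  good (sf_prod f) /\ h (sf_prod f) = sf_prod (fun i => h (f i)).
Proof.
move=> gf; rewrite /sf_prod; elim: (enum _) => [|i s [gs IHs]] /=.
  exact: hom_one hh.
by have [? ->] := hom_mul hh (gf i) gs; rewrite IHs.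
Qed.

Lemma hom_ypat n (B : 'M[int]_n) (y : 'I_n -> A) v j : (forall i, good (y i)) ->
  good (ypat B y v j) /\ h (ypat B y v j) = ypat B (fun i => h (y i)) v j.
Proof.
elim: v B y => [|k v IHv] B y gy //=.
suff E i : good (ymut k B y i) /\ h (ymut k B y i) = ymut k B (fun i => h (y i)) i.
  have [|? ->] := IHv (mutmx k B) (ymut k B y); first by move=> i; case: (E i).
  by split=> //; congr (ypat _ _ v j); apply: funext => i; case: (E i).
rewrite /ymut; case: eqP => _; first by have [? ->] := hom_inv hh (gy k).
have [g1 E1] := hom_expz (- sgz (B k i)) (gy k).
have [g2 E2] := hom_add hh (hom_one hh).1 g1.
have [g3 E3] := hom_expz (- B k i) g2.
by have [? ->] := hom_mul hh (gy i) g3; rewrite E3 E2 E1 (hom_one hh).2.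
Qed.

Variables (P : sfops) (iota : P -> A).
Hypothesis g_iota : forall x, good (iota x).

Lemma hom_cpat n (B : 'M[int]_n) (p : 'I_n -> P) (x : 'I_n -> A) v j :
  (forall i, good (x i)) -> good (cpat iota B p x v j) /\
  h (cpat iota B p x v j) = cpat (fun c => h (iota c)) B p (fun i => h (x i)) v j.
Proof.
elim: v B p x => [|k v IHv] B p x gx //=.
suff E i : good (cmut iota k B p x i) /\
    h (cmut iota k B p x i) = cmut (fun c => h (iota c)) k B p (fun i => h (x i)) i.
  have [|? ->] := IHv (mutmx k B) (ymut k B p) (cmut iota k B p x).
    by move=> i; case: (E i).
  by split=> //; congr (cpat _ _ _ _ v j); apply: funext => i; case: (E i).
rewrite /cmut; case: eqP => _ //.
have prodE (b : pred 'I_n) (e : 'I_n -> int) :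
    good (sf_prod (fun i => if b i then sf_expz (x i) (e i) else sf_one A)) /\
    h (sf_prod (fun i => if b i then sf_expz (x i) (e i) else sf_one A)) =
    sf_prod (fun i => if b i then sf_expz (h (x i)) (e i) else sf_one Q).
  have [i'|? ->] := @hom_prod n (fun i => if b i then sf_expz (x i) (e i) else sf_one A).
    by case: (b i'); [case: (hom_expz (e i') (gx i')) | case: (hom_one hh)].
  split=> //; congr sf_prod; apply: funext => i'.
  by case: (b i'); [case: (hom_expz (e i') (gx i')) | case: (hom_one hh)].
have [g1 E1] := prodE (fun i => B i k < 0) (fun i => - B i k).
have [g2 E2] := prodE (fun i => 0 < B i k) (fun i => B i k).
have [g3 E3] := hom_mul hh (g_iota (sf_minus (p k))) g1.
have [g4 E4] := hom_mul hh (g_iota (sf_plus (p k))) g2.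
have [g5 E5] := hom_add hh g3 g4; have [g6 E6] := hom_inv hh (gx k).
by rewrite /sf_div; have [? ->] := hom_mul hh g5 g6; rewrite E6 E5 E4 E3 E2 E1.
Qed.

Lemma hom_ycpat n (B : 'M[int]_n) (p : 'I_n -> P) (y : 'I_n -> A) v j :
  (forall i, good (y i)) -> good (ycpat iota B p y v j) /\
  h (ycpat iota B p y v j) = ycpat (fun c => h (iota c)) B p (fun i => h (y i)) v j.
Proof.
elim: v B p y => [|k v IHv] B p y gy //=.
suff E i : good (ycmut iota k B p y i) /\
    h (ycmut iota k B p y i) = ycmut (fun c => h (iota c)) k B p (fun i => h (y i)) i.
  have [|? ->] := IHv (mutmx k B) (ymut k B p) (ycmut iota k B p y).
    by move=> i; case: (E i).
  by split=> //; congr (ycpat _ _ _ _ v j); apply: funext => i; case: (E i).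
rewrite /ycmut; case: eqP => _; first by have [? ->] := hom_inv hh (gy k).
have [g1 E1] := hom_expz (- sgz (B k i)) (gy k).
have [g2 E2] := hom_mul hh (g_iota (sf_bracket (p k) (- B k i))) g1.
have [g3 E3] := hom_add hh (g_iota (sf_bracket (p k) (B k i))) g2.
have [g4 E4] := hom_expz (- B k i) g3.
by have [? ->] := hom_mul hh (gy i) g4; rewrite E4 E3 E2 E1.
Qed.

Lemma hom_eval_frac n (q : 'I_n -> A) (X : fracsf P n) : (forall i, good (q i)) ->
  good (eval_frac iota q X) /\
  h (eval_frac iota q X) = eval_frac (fun c => h (iota c)) (fun i => h (q i)) X.
Proof.
move=> gq; pose ev := eval_mono iota q.
have Em m : good (ev m) /\ h (ev m) = eval_mono (fun c => h (iota c)) (fun i => h (q i)) m.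
  have [i|g1 E1] := @hom_prod n (fun i => sf_expz (q i) (m.2 i)).
    by case: (hom_expz (m.2 i) (gq i)).
  rewrite /ev /eval_mono; have [? ->] := hom_mul hh (g_iota m.1) g1; split=> //.
  rewrite E1; congr (sf_mul _ _ (sf_prod _)); apply: funext => i.
  by case: (hom_expz (m.2 i) (gq i)).
have Ep s : good (eval_poly iota q s) /\ h (eval_poly iota q s) =
    eval_poly (fun c => h (iota c)) (fun i => h (q i)) s.
  case: s => [|m s] /=; first exact: hom_one hh.
  elim: s => [|m' s [gs IHs]] //=.
  by have [? ->] := hom_add hh (Em m').1 gs; rewrite (Em m').2 IHs.
rewrite /eval_frac /sf_div; have [g E] := hom_inv hh (Ep (fden X)).1.
by have [? ->] := hom_mul hh (Ep (fnum X)).1 g; rewrite E !(Ep _).2.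
Qed.

End Hom.

(* Ratios with an empty numerator or denominator are junk: they represent no
   element of the semifield. *)
Definition proper (P : sfops) n (X : fracsf P n) : bool :=
  ~~ nilp (fnum X) && ~~ nilp (fden X).

Lemma nilp_pmul (P : sfops) n (s t : seq (mono P n)) :
  nilp (pmul s t) = nilp s || nilp t.
Proof. by rewrite /nilp size_allpairs muln_eq0. Qed.

Lemma nilp_cat (T : Type) (s t : seq T) : nilp (s ++ t) = nilp s && nilp t.
Proof. by rewrite /nilp size_cat addn_eq0. Qed.

Lemma proper_add (P : sfops) n (X Y : fracsf P n) :
  proper X -> proper Y -> proper (sf_add (fracsf P n) X Y).
Proof.
case/andP=> X0 X1 /andP[Y0 Y1]; rewrite /proper nilp_cat !nilp_pmul.
by rewrite (negPf X0) (negPf X1) (negPf Y1).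
Qed.

Lemma proper_mul (P : sfops) n (X Y : fracsf P n) :
  proper X -> proper Y -> proper (sf_mul (fracsf P n) X Y).
Proof.
case/andP=> X0 X1 /andP[Y0 Y1]; rewrite /proper !nilp_pmul.
by rewrite (negPf X0) (negPf X1) (negPf Y0) (negPf Y1).
Qed.

Lemma proper_inv (P : sfops) n (X : fracsf P n) : proper X -> proper (sf_inv (fracsf P n) X).
Proof. by rewrite /proper andbC. Qed.

(** * Evaluation of ratios of polynomials in a semifield *)

Section Evaluation.
Variables (P : sfops) (n : nat) (Q : semifield).
Variables (phi : P -> mulgroup Q) (q : 'I_n -> Q).
Hypothesis phi1 : phi (sf_one P) = 0.
Hypothesis phiM : forall x y, phi (sf_mul P x y) = phi x + phi y.

Let ev (m : mono P n) : mulgroup Q := eval_mono phi q m.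
Let evp (s : seq (mono P n)) : mulgroup Q := eval_poly phi q s.

Lemma eval_monoE m : ev m = phi m.1 + \sum_i (q i : mulgroup Q) *~ m.2 i.
Proof.
rewrite /ev /eval_mono sf_prodE; congr (_ + _ : mulgroup Q).
by apply: eq_bigr => i _; rewrite sf_expzE.
Qed.

Lemma eval_mono_mul a b : ev (mmul a b) = ev a + ev b.
Proof.
rewrite !eval_monoE phiM addrACA; congr (_ + _ : mulgroup Q).
by rewrite -big_split; apply: eq_bigr => i _ /=; rewrite ffunE mulrzDr.
Qed.

Lemma eval_mono_one : ev (mone P n) = 0.
Proof. by rewrite eval_monoE phi1 add0r big1 // => i _; rewrite ffunE. Qed.

(** For lack of a zero, [eval_poly] starts its fold from the head, which ends up innermost;
    commutativity brings it back to the front. *)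
Lemma eval_poly_cons a s : ~~ nilp s -> evp (a :: s) = oplus (ev a) (evp s).
Proof.
pose f m (x : mulgroup Q) := oplus (ev m) x.
have foldrD x y t : foldr f (oplus x y) t = oplus x (foldr f y t).
  by elim: t => [|m t IHt] //=; rewrite IHt /f !oplusA (oplusC x).
case: s => [|b s] //= _; rewrite /evp /= -/f.
by rewrite -[LHS]/(oplus (ev b) (foldr f (ev a) s)) -foldrD [in LHS](oplusC (ev b)) foldrD.
Qed.

Lemma eval_poly_cat s t : ~~ nilp s -> ~~ nilp t ->
  evp (s ++ t) = oplus (evp s) (evp t).
Proof.
elim: s => [|a [|b s] IHs] // _ t0; first by rewrite cat1s eval_poly_cons.
by rewrite cat_cons eval_poly_cons // IHs // (eval_poly_cons a) // oplusA.
Qed.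

Lemma eval_poly_mul s t : ~~ nilp s -> ~~ nilp t ->
  evp (pmul s t) = evp s + evp t.
Proof.
move=> s0 t0.
have map_mul a : evp [seq mmul a b | b <- t] = ev a + evp t.
  elim: t t0 => [|b [|c t] IHt] // _; first exact: eval_mono_mul.
  rewrite map_cons eval_poly_cons // IHt // eval_mono_mul.
  by rewrite (eval_poly_cons b) // oplusDr.
elim: s s0 => [|a [|b s] IHs] // _; first by rewrite /pmul /= cats0 map_mul.
rewrite -[pmul _ _]/([seq mmul a b | b <- t] ++ pmul (b :: s) t).
rewrite eval_poly_cat ?nilp_pmul ?negb_or ?t0 //; last by case: (t) t0.
by rewrite IHs // map_mul (eval_poly_cons a) // oplusDl.
Qed.

Lemma eval_frac_hom :
  sf_hom (A := fracsf P n) (Q := Q) (@proper P n) (eval_frac phi q).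
Proof.
have evE X : eval_frac phi q X = evp (fnum X) - evp (fden X) by [].
split=> [X Y pX pY|X Y pX pY||X pX].
- split; first exact: proper_add.
  case/andP: pX pY => X0 X1 /andP[Y0 Y1]; rewrite -/(oplus _ _) !evE /=.
  rewrite eval_poly_cat ?nilp_pmul ?negb_or ?X0 ?X1 ?Y0 ?Y1 // !eval_poly_mul //.
  rewrite oplusDl !opprD addrACA subrr addr0; congr oplus.
  by rewrite addrA addrK.
- split; first exact: proper_mul.
  case/andP: pX pY => X0 X1 /andP[Y0 Y1].
  rewrite -[RHS]/((_ : mulgroup Q) + _) !evE /= !eval_poly_mul //.
  by rewrite opprD addrACA.
- by split=> //; rewrite evE subrr.
- split; first exact: proper_inv.
  by rewrite -[RHS]/(- (_ : mulgroup Q)) !evE opprB.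
Qed.

End Evaluation.

(** * Equality of ratios, and S as a quotient semifield *)

Definition monogroup (P : semifield) n : zmodType := (mulgroup P * {ffun 'I_n -> int})%type.

Section FractionEquality.
Variables (P : semifield) (n : nat).
Let G := monogroup P n.

(* A wrapper, because [transitivity] and [rewrite] would see through [is_true]
   to an equality of booleans. *)
Variant peq (s t : seq G) : Prop := Peq of perm_eq s t.

(** [mmul] is convertible to the addition of P x Z^n, so [pmul] is the product [mulp] of N[G]. *)
Lemma frac_eqE (X Y : fracsf P n) :
  frac_eq X Y <-> peq (mulp (fnum X : seq G) (fden Y)) (mulp (fnum Y : seq G) (fden X)).
Proof.
have E := Permutation_perm_eq (mulp (fnum X : seq G) (fden Y)) (mulp (fnum Y : seq G) (fden X)).
by split=> [XY|[XY]]; [constructor; apply (proj1 E XY) | apply (proj2 E XY)].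
Qed.

Lemma monogroup_torsion_free (x : G) m : x *+ m.+1 = 0 -> x = 0.
Proof.
case: x => a e.
have pairMn k : ((a, e) : G) *+ k = (a *+ k, e *+ k).
  by elim: k => // k; rewrite !mulrS => ->.
rewrite pairMn => -[/mulgroup_torsion_free -> e0]; congr pair.
apply/ffunP => i; have := congr1 (fun g : {ffun 'I_n -> int} => g i) e0.
by rewrite ffunMnE !ffunE => /eqP; rewrite mulrn_eq0 => /eqP.
Qed.

Lemma peq_cancel (c s t : seq G) : ~~ nilp c -> peq (mulp c s) (mulp c t) -> peq s t.
Proof.
move=> c0 [st]; constructor; apply: (mulp_cancel monogroup_torsion_free) st.
by case: c c0.
Qed.

#[local] Instance peq_equiv : Equivalence peq.
Proof.
split=> [s|s t [st]|s t u [st] [tu]]; constructor; rewrite // 1?perm_sym //.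
by rewrite perm_sym; apply: seq.perm_trans st tu.
Qed.

#[local] Instance cat_proper : Proper (peq ==> peq ==> peq) (@cat G).
Proof. by move=> s s' [ss] t t' [tt]; constructor; apply: perm_cat. Qed.

#[local] Instance mulp_proper : Proper (peq ==> peq ==> peq) (@mulp G).
Proof. by move=> s s' [ss] t t' [tt]; constructor; apply: perm_mulp. Qed.

Fact peq_ext : sring_eq_ext cat (@mulp G) peq.
Proof. by split; [exact: cat_proper | exact: mulp_proper]. Qed.

Fact peq_semiring : semi_ring_theory [::] [:: 0 : G] cat (@mulp G) peq.
Proof. by case: (seq_semiring G) => *; split=> *; constructor. Qed.

Add Ring monogroup_ring : peq_semiring (setoid peq_equiv peq_ext).

Section CrossProducts.
Variables a b c d a' b' c' d' : seq G.

(** Transitivity for a/b = c/d = a'/b': the cross products agree after multiplication by d, which is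
    then cancelled. *)
Lemma peq_cross_trans : ~~ nilp d ->
  peq (mulp a d) (mulp c b) -> peq (mulp c b') (mulp a' d) ->
  peq (mulp a b') (mulp a' b).
Proof.
move=> d0 E1 E2; suff H : peq (mulp d (mulp a b')) (mulp d (mulp a' b)).
  exact: peq_cancel d0 H.
transitivity (mulp (mulp a d) b'); first by ring.
rewrite E1; transitivity (mulp (mulp c b') b); first by ring.
rewrite E2; ring.
Qed.

Hypothesis ab : peq (mulp a b') (mulp a' b).

Lemma peq_cross_inv : peq (mulp b a') (mulp b' a).
Proof. transitivity (mulp a' b); first by ring. rewrite -ab; ring. Qed.

Hypothesis cd : peq (mulp c d') (mulp c' d).

Lemma peq_cross_add :
  peq (mulp (mulp a d ++ mulp c b) (mulp b' d')) (mulp (mulp a' d' ++ mulp c' b') (mulp b d)).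
Proof.
transitivity (mulp (mulp a b') (mulp d d') ++ mulp (mulp c d') (mulp b b')).
  by ring.
rewrite ab cd; ring.
Qed.

Lemma peq_cross_mul :
  peq (mulp (mulp a c) (mulp b' d')) (mulp (mulp a' c') (mulp b d)).
Proof.
transitivity (mulp (mulp a b') (mulp c d')); first by ring.
rewrite ab cd; ring.
Qed.

End CrossProducts.

Implicit Types X Y Z : fracsf P n.

Lemma frac_eq_refl X : frac_eq X X.
Proof. exact: Permutation_refl. Qed.

Lemma frac_eq_sym X Y : frac_eq X Y -> frac_eq Y X.
Proof. exact: Permutation_sym. Qed.

(** The ratio of two empty polynomials is [frac_eq] to every ratio, hence the condition on the
    middle term. *)
Lemma frac_eq_trans X Y Z : proper Y -> frac_eq X Y -> frac_eq Y Z -> frac_eq X Z.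
Proof. by case/andP=> _ Y1; rewrite !frac_eqE; apply: peq_cross_trans. Qed.

Lemma frac_eq_add X X' Y Y' : frac_eq X X' -> frac_eq Y Y' ->
  frac_eq (sf_add (fracsf P n) X Y) (sf_add (fracsf P n) X' Y').
Proof. by rewrite !frac_eqE; apply: peq_cross_add. Qed.

Lemma frac_eq_mul X X' Y Y' : frac_eq X X' -> frac_eq Y Y' ->
  frac_eq (sf_mul (fracsf P n) X Y) (sf_mul (fracsf P n) X' Y').
Proof. by rewrite !frac_eqE; apply: peq_cross_mul. Qed.

Lemma frac_eq_inv X X' : frac_eq X X' ->
  frac_eq (sf_inv (fracsf P n) X) (sf_inv (fracsf P n) X').
Proof. by rewrite !frac_eqE; apply: peq_cross_inv. Qed.

Section CrossAxioms.
Variables a b c d e f : seq G.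

(** This fact and the next ones are the semifield axioms for a/b, c/d, e/f, in the cross-multiplied
    shape to which [frac_eq] unfolds. *)
Fact peq_addA : peq
  (mulp (mulp a (mulp d f) ++ mulp (mulp c f ++ mulp e d) b) (mulp (mulp b d) f))
  (mulp (mulp (mulp a d ++ mulp c b) f ++ mulp e (mulp b d)) (mulp b (mulp d f))).
Proof. ring. Qed.

Fact peq_addC : peq
  (mulp (mulp a d ++ mulp c b) (mulp d b)) (mulp (mulp c b ++ mulp a d) (mulp b d)).
Proof. ring. Qed.

Fact peq_mulA : peq
  (mulp (mulp a (mulp c e)) (mulp (mulp b d) f))
  (mulp (mulp (mulp a c) e) (mulp b (mulp d f))).
Proof. ring. Qed.

Fact peq_mulC : peq (mulp (mulp a c) (mulp d b)) (mulp (mulp c a) (mulp b d)).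
Proof. ring. Qed.

Fact peq_mul1 : peq (mulp (mulp [:: 0] a) b) (mulp a (mulp [:: 0] b)).
Proof. ring. Qed.

Fact peq_mulV : peq (mulp (mulp b a) [:: 0]) (mulp [:: 0] (mulp a b)).
Proof. ring. Qed.

Fact peq_mulDl : peq
  (mulp (mulp (mulp a d ++ mulp c b) e) (mulp (mulp b f) (mulp d f)))
  (mulp (mulp (mulp a e) (mulp d f) ++ mulp (mulp c e) (mulp b f)) (mulp (mulp b d) f)).
Proof. ring. Qed.

End CrossAxioms.

(* The quotient is taken on all ratios; [tidy] replaces the junk ones by 1. *)
Definition tidy X : fracsf P n := if proper X then X else sf_one (fracsf P n).

Lemma tidy_proper X : proper (tidy X).
Proof. by rewrite /tidy; case: ifP. Qed.

Lemma tidy_id X : proper X -> tidy X = X.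
Proof. by rewrite /tidy => ->. Qed.

(** [{classic _}] provides the choice structure required by [{eq_quot _}]. *)
Definition tidy_eq : rel {classic fracsf P n} :=
  fun X Y => `[< frac_eq (tidy X) (tidy Y) >].

Fact tidy_eq_refl : ssrbool.reflexive tidy_eq.
Proof. by move=> X; apply/asboolP/frac_eq_refl. Qed.

Fact tidy_eq_sym : ssrbool.symmetric tidy_eq.
Proof. by move=> X Y; apply/asboolP/asboolP; apply: frac_eq_sym. Qed.

Fact tidy_eq_trans : ssrbool.transitive tidy_eq.
Proof.
move=> X Y Z /asboolP YX /asboolP XZ; apply/asboolP.
exact: frac_eq_trans (tidy_proper X) YX XZ.
Qed.

Canonical tidy_eq_equiv :=
  EquivRel tidy_eq tidy_eq_refl tidy_eq_sym tidy_eq_trans.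

Definition fracquot := {eq_quot tidy_eq}%qT.
Definition fracpi X : fracquot := \pi_fracquot%qT (X : {classic fracsf P n}).
(** The class of 1 also contains the junk ratios, so [repr] may return one; [tidy] repairs it within
    the class. *)
Definition fracrepr (x : fracquot) : fracsf P n := tidy (repr x).

Lemma fracrepr_proper x : proper (fracrepr x).
Proof. exact: tidy_proper. Qed.

Lemma fracpiP X Y : proper X -> proper Y -> fracpi X = fracpi Y <-> frac_eq X Y.
Proof.
move=> pX pY; rewrite -{2}(tidy_id pX) -{2}(tidy_id pY).
by split=> [/eqquotP/asboolP|XY] //; apply/eqquotP/asboolP.
Qed.

Lemma fracreprK x : fracpi (fracrepr x) = x.
Proof.
rewrite -[RHS]reprK; apply/eqquotP/asboolP.
by rewrite (tidy_id (fracrepr_proper x)); apply: frac_eq_refl.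
Qed.

Lemma fracpiK X : proper X -> frac_eq (fracrepr (fracpi X)) X.
Proof. by move=> pX; apply/fracpiP; rewrite ?fracreprK ?fracrepr_proper. Qed.

Definition fracquot_ops : sfops := @SFOps fracquot
  (fun x y => fracpi (sf_add (fracsf P n) (fracrepr x) (fracrepr y)))
  (fun x y => fracpi (sf_mul (fracsf P n) (fracrepr x) (fracrepr y)))
  (fracpi (sf_one (fracsf P n)))
  (fun x => fracpi (sf_inv (fracsf P n) (fracrepr x))).

Lemma fracpi_hom : sf_hom (A := fracsf P n) (Q := fracquot_ops) (@proper P n) fracpi.
Proof.
split=> [X Y pX pY|X Y pX pY||X pX]; split=> //.
- exact: proper_add.
- apply/fracpiP; rewrite ?proper_add ?fracrepr_proper //.
  by apply: frac_eq_add; apply: frac_eq_sym; apply: fracpiK.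
- exact: proper_mul.
- apply/fracpiP; rewrite ?proper_mul ?fracrepr_proper //.
  by apply: frac_eq_mul; apply: frac_eq_sym; apply: fracpiK.
- exact: proper_inv.
- apply/fracpiP; rewrite ?proper_inv ?fracrepr_proper //.
  by apply: frac_eq_inv; apply: frac_eq_sym; apply: fracpiK.
Qed.

Fact fracquot_semifield : is_semifield fracquot_ops.
Proof.
have add := hom_add fracpi_hom; have mul := hom_mul fracpi_hom.
have piE x : exists2 X, proper X & x = fracpi X.
  by exists (fracrepr x); rewrite ?fracrepr_proper ?fracreprK.
have [one1 oneE] := hom_one fracpi_hom.
split=> [x y z|].
  case: (piE x) (piE y) (piE z) => X pX -> [Y pY ->] [Z pZ ->].
  have [gYZ <-] := add _ _ pY pZ; have [gXY <-] := add _ _ pX pY.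
  have [? <-] := add _ _ pX gYZ; have [? <-] := add _ _ gXY pZ.
  by apply/fracpiP => //; rewrite frac_eqE; apply: peq_addA.
split=> [x y|].
  case: (piE x) (piE y) => X pX -> [Y pY ->].
  have [? <-] := add _ _ pX pY; have [? <-] := add _ _ pY pX.
  by apply/fracpiP => //; rewrite frac_eqE; apply: peq_addC.
split=> [x y z|].
  case: (piE x) (piE y) (piE z) => X pX -> [Y pY ->] [Z pZ ->].
  have [gYZ <-] := mul _ _ pY pZ; have [gXY <-] := mul _ _ pX pY.
  have [? <-] := mul _ _ pX gYZ; have [? <-] := mul _ _ gXY pZ.
  by apply/fracpiP => //; rewrite frac_eqE; apply: peq_mulA.
split=> [x y|].
  case: (piE x) (piE y) => X pX -> [Y pY ->].
  have [? <-] := mul _ _ pX pY; have [? <-] := mul _ _ pY pX.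
  by apply/fracpiP => //; rewrite frac_eqE; apply: peq_mulC.
split=> [x|].
  case: (piE x) => X pX ->; rewrite -oneE; have [? <-] := mul _ _ one1 pX.
  by apply/fracpiP => //; rewrite frac_eqE; apply: peq_mul1.
split=> [x|x y z].
  case: (piE x) => X pX ->; have [pV <-] := hom_inv fracpi_hom pX.
  rewrite -oneE; have [? <-] := mul _ _ pV pX.
  by apply/fracpiP => //; rewrite frac_eqE; apply: peq_mulV.
case: (piE x) (piE y) (piE z) => X pX -> [Y pY ->] [Z pZ ->].
have [gXY <-] := add _ _ pX pY; have [? <-] := mul _ _ gXY pZ.
have [gXZ <-] := mul _ _ pX pZ; have [gYZ <-] := mul _ _ pY pZ.
have [? <-] := add _ _ gXZ gYZ.
by apply/fracpiP => //; rewrite frac_eqE; apply: peq_mulDl.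
Qed.

Definition fracquotS : semifield := Semifield fracquot_semifield.

End FractionEquality.

(** * Specialization of Y-patterns and F-polynomials *)

Section EvaluationGenerators.
Variables (P : sfops) (Q : semifield) (n : nat).
Variables (phi : P -> mulgroup Q) (q : 'I_n -> mulgroup Q).
Hypothesis phi1 : phi (sf_one P) = 0.

Lemma eval_single (m : mono P n) :
  eval_frac phi q (Frac [:: m] [:: mone P n]) = eval_mono phi q m.
Proof.
rewrite -[LHS]/((eval_mono phi q m : mulgroup Q) - (eval_mono phi q (mone P n) : mulgroup Q)).
by rewrite eval_mono_one // subr0.
Qed.

Lemma eval_fgen i : eval_frac phi q (fgen P i) = q i.
Proof. by rewrite eval_single eval_monoE phi1 add0r; apply: trop_eval_delta. Qed.

Lemma eval_fconst c : eval_frac phi q (fconst n c) = phi c.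
Proof. by rewrite eval_single eval_monoE big1 ?addr0 // => i _; rewrite ffunE. Qed.

End EvaluationGenerators.

Section Specialization.
Variables (Q : semifield) (n : nat) (q : 'I_n -> mulgroup Q).

Lemma sf_image_hom :
  sf_hom (A := Qsf n) (Q := Q) (@proper unitsf n) (fun X : Qsf n => sf_image X q).
Proof. by apply: eval_frac_hom => // x y; rewrite addr0. Qed.

Lemma sf_image_ypat B v j :
  sf_image (ypat B (fun i => fgen unitsf i) v j : Qsf n) q = ypat B q v j.
Proof.
have [|_ ->] := hom_ypat sf_image_hom B v j (y := fun i => fgen unitsf i) => //.
by congr (ypat _ _ v j); apply: funext => i; apply: eval_fgen.
Qed.

Lemma proper_spec_x1 (X : fracsf (trop n) n) : proper (spec_x1 X) = proper X.
Proof. by rewrite /proper /nilp !size_map. Qed.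

(** Setting x_i = 1 and then z_i = q_i amounts to one evaluation, with x_i sent to 1 and a
    coefficient z^c to q^c. The latter map only has to be multiplicative, since coefficients are
    never added in Trop(z) here. *)
Lemma sf_image_spec_x1 (X : fracsf (trop n) n) :
  sf_image (spec_x1 X) q = eval_frac (trop_eval q) (fun=> 0 : mulgroup Q) X.
Proof.
have monoE (m : mono (trop n) n) : eval_mono (fun=> sf_one Q) q ((tt : unitsf), m.1) =
    eval_mono (trop_eval q) (fun=> 0 : mulgroup Q) m.
  rewrite /eval_mono !sf_prodE /= -[LHS]/(0 + _ : mulgroup Q) add0r.
  rewrite -[RHS]/((trop_eval q m.1) + _ : mulgroup Q) [X in _ + X]big1 ?addr0.
    by apply: eq_bigr => i _; rewrite sf_expzE.
  by move=> i _; rewrite sf_expzE mul0rz.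
have polyE (s : seq (mono (trop n) n)) :
    eval_poly (fun=> sf_one Q) q [seq ((tt : unitsf), m.1) | m <- s] =
    eval_poly (trop_eval q) (fun=> 0 : mulgroup Q) s.
  by case: s => //= m s; elim: s => [|m' s IHs] /=; rewrite monoE // IHs.
by rewrite /sf_image /eval_frac /= !polyE.
Qed.

Lemma XFZ_hom B v i : proper (XFZ B v i) /\
  eval_frac (trop_eval q) (fun=> 0 : mulgroup Q) (XFZ B v i) =
  cpat (trop_eval q) B (@delta n) (fun=> 0 : mulgroup Q) v i.
Proof.
have te0 : trop_eval q (sf_one (trop n)) = 0.
  by apply: big1 => k _; rewrite ffunE.
have hom : sf_hom (A := fracsf (trop n) n) (Q := Q) (@proper (trop n) n)
    (eval_frac (trop_eval q) (fun=> 0 : mulgroup Q)).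
  by apply: eval_frac_hom => // c d; apply: trop_evalD.
have [||-> ->] := hom_cpat hom (iota := @fconst (trop n) n) _ B (@delta n) v i
  (x := fun i => fgen (trop n) i) => //; split=> //.
by congr (cpat _ _ _ _ v i); apply: funext => c; [apply: eval_fconst | apply: eval_fgen].
Qed.

Lemma sf_image_Fpoly B v i k : sf_image (sf_expz (Fpoly B v i) k) q =
  (cpat (trop_eval q) B (@delta n) (fun=> 0 : mulgroup Q) v i : mulgroup Q) *~ k.
Proof.
have [pX XE] := XFZ_hom B v i.
have [|_ ->] := hom_expz sf_image_hom k (x := Fpoly B v i).
  by rewrite proper_spec_x1.
by rewrite sf_expzE sf_image_spec_x1 XE.
Qed.

End Specialization.

(** [ypat_separation] for the initial seed y = q, c_i = z_i, f_i = 1: its tropical Y-pattern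
    consists of the c-vectors, and its cluster pattern of the values F_i(q). *)
Lemma ypat_Fpoly (Q : semifield) n (B : 'M[int]_n) (q : 'I_n -> mulgroup Q) v j :
  skew_symmetrizable B ->
  ypat B q v j = trop_eval q (cvec B v j) +
    \sum_i (sf_image (sf_expz (Fpoly B v i) (Bpat B v i j)) q : mulgroup Q).
Proof.
move=> Bskew; rewrite (ypat_separation (q := q) (c := @delta n) (f := fun=> 0 : mulgroup Q)) //.
  rewrite /cvec (@sf_image_ypat (tropS n)); congr (_ + _ : mulgroup Q).
  by apply: eq_bigr => i _; rewrite sf_image_Fpoly.
by move=> i; rewrite trop_eval_delta big1 ?addr0 // => k _; rewrite mul0rz.
Qed.


(** * The formula with coefficients in S *)

(** Writes an exponent vector as a combination of the [delta i], so that a group morphism can be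
    applied term by term in [fracpi_fmono]. *)
Lemma trop_eval_id n (c : trop n) : trop_eval (Q := tropS n) (@delta n) c = c.
Proof.
apply/ffunP => j.
have := @big_morph _ _ (fun d : mulgroup (tropS n) => (d : trop n) j) 0 +%R 0 +%R.
move=> ->; last by rewrite ffunE.
  2: by move=> d e; rewrite ffunE.
rewrite (bigD1 j) //= big1 => [|i /negPf ij]; rewrite tropMzE ffunE.
  by rewrite eqxx mul1r addr0.
by rewrite eq_sym ij mul0r.
Qed.

Section Monomials.
Variables (P : semifield) (n : nat).
Let S := fracquotS P n.
Let G := monogroup P n.

Definition monopi (m : G) : mulgroup S := fracpi (Frac [:: m : mono P n] [:: mone P n]).

Lemma monopiD a b : monopi (a + b) = monopi a + monopi b.
Proof.
pose X m := Frac [:: m : mono P n] [:: mone P n] : fracsf P n.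
have pX m : proper (X m) by [].
have [_ E] := hom_mul (fracpi_hom P n) (pX a) (pX b).
rewrite -[RHS]E; apply/fracpiP => //; rewrite frac_eqE; constructor.
rewrite -[X in perm_eq X _]/[:: a + b + (0 + 0)] -[X in perm_eq _ X]/[:: a + b + 0].
by rewrite !addr0.
Qed.

Definition constpi (c : P) : mulgroup S := fracpi (fconst n c).
Definition genpi (i : 'I_n) : mulgroup S := fracpi (fgen P i).

Lemma constpiD (x y : mulgroup P) : constpi (x + y) = constpi x + constpi y.
Proof.
by rewrite -[RHS]monopiD; congr (monopi (_, _)); apply/ffunP => i; rewrite !ffunE.
Qed.

Lemma fracpi_fmono e : fracpi (fmono P e) = trop_eval genpi e.
Proof.
pose iota (d : tropS n) : mulgroup S := monopi (0, d).
have iotaD (d d' : mulgroup (tropS n)) : iota (d + d') = iota d + iota d'.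
  by rewrite -[RHS]monopiD; congr monopi; congr pair; rewrite addr0.
by rewrite -[LHS]/(iota e) -{1}(trop_eval_id e) (mulgroup_morph_trop_eval iotaD).
Qed.

End Monomials.

Lemma separation_with_coefficients (P : semifield) n (B : 'M[int]_n) (p : 'I_n -> mulgroup P)
    v j : skew_symmetrizable B ->
  let S := fracsf P n in
  frac_eq (Ytil B p v j)
    (sf_mul S
       (sf_mul S
          (fconst n (sf_prod (fun i : 'I_n =>
             sf_image (sf_expz (Fpoly B v i) (- Bpat B v i j)) p)))
          (sf_prod (fun i : 'I_n =>
             sf_image (Q := S) (sf_expz (Fpoly B v i) (Bpat B v i j))
               (fun i' => sf_mul S (fconst n (p i')) (fgen P i')))))
       (fmono P (cvec B v j))).
Proof.
move=> Bskew S.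
have hom := fracpi_hom P n.
have pc (c : P) : proper (fconst n c) by [].
have pg (i : 'I_n) : proper (fgen P i) by [].
have iD := @constpiD P n.
pose q i : mulgroup (fracquotS P n) := constpi n (p i) + genpi P i.
have [pL EL] := hom_ycpat hom pc B p v j pg.
have p1 : proper (sf_one S) by [].
have py i : proper (sf_mul S (fconst n (p i)) (fgen P i)) by [].
have qE : (fun i => fracpi (sf_mul S (fconst n (p i)) (fgen P i))) = q.
  by apply: funext => i; have [_ ->] := hom_mul hom (pc (p i)) (pg i).
(* The theorem evaluates F-polynomials in raw ratios; passing to the quotient turns this into
   evaluation at [q], that is at p_i y_i, in an honest semifield. *)
have im (X : Qsf n) := hom_eval_frac hom (iota := fun _ : unitsf => sf_one S) (fun=> p1) X py.
have [pF EF] := hom_prod hom (fun i => (im (sf_expz (Fpoly B v i) (Bpat B v i j))).1).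
have [pCF ECF] := hom_mul hom (pc (sf_prod (fun i : 'I_n =>
             sf_image (sf_expz (Fpoly B v i) (- Bpat B v i j)) p))) pF.
have pm : proper (fmono P (cvec B v j)) by [].
have [pR ER] := hom_mul hom pCF pm.
apply/fracpiP => //.
rewrite {}ER {}ECF {}EF fracpi_fmono [LHS]EL.
(* Multiplying by Y_j(p) turns the left side into Y_j(p y); then [ypat_Fpoly] applies both in P and
   in the quotient. *)
apply: (addrI (constpi n (ypat B p v j))).
rewrite (ycpat_ypat iD) !ypat_Fpoly //.
pose W := \sum_i (sf_image (sf_expz (Fpoly B v i) (Bpat B v i j)) q : mulgroup (fracquotS P n)).
pose U := \sum_i (sf_image (sf_expz (Fpoly B v i) (Bpat B v i j)) p : mulgroup P).
have WE : sf_prod (P := fracquotS P n) (fun i => fracpi (eval_frac (fun _ : unitsf => sf_one S)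
    (fun i' => sf_mul S (fconst n (p i')) (fgen P i'))
    (sf_expz (Fpoly B v i) (Bpat B v i j)))) = W.
  by rewrite sf_prodE; apply: eq_bigr => i _; rewrite (im _).2 qE.
have UE : sf_prod (fun i => sf_image (sf_expz (Fpoly B v i) (- Bpat B v i j)) p) = - U.
  rewrite sf_prodE -sumrN; apply: eq_bigr => i _.
  by rewrite !sf_image_Fpoly mulrNz.
(* (p y)^c = p^c y^c; the factor p^c then cancels against the one in Y_j(p). *)
have qc : trop_eval q (cvec B v j) =
    constpi n (trop_eval p (cvec B v j)) + trop_eval (genpi P (n := n)) (cvec B v j).
  rewrite (mulgroup_morph_trop_eval iD) -big_split; apply: eq_bigr => i _ /=.
  by rewrite -mulrzDl.
rewrite UE WE -/U -/W iD qc.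
rewrite -[X in _ = _ + X]/((constpi n (- U) + W) + trop_eval (genpi P (n := n)) (cvec B v j)).
by rewrite (mulgroup_morphN iD) -!addrA; congr (_ + _ : mulgroup _); rewrite addNKr addrC.
Qed.

(* S = Q P_sf(y_1..y_n) is fracsf P n; equality in S is frac_eq. *)
Theorem mainTheorem2 (P : sfops) (n : nat) (B0 : 'M[int]_n) (p : 'I_n -> P) :
  is_semifield P -> skew_symmetrizable B0 ->
  forall (v : seq 'I_n), reduced v -> forall j : 'I_n,
  let Bv := Bpat B0 v in
  let S := fracsf P n in
  frac_eq (Ytil B0 p v j)
    (sf_mul S
       (sf_mul S
          (fconst n (sf_prod (fun i : 'I_n =>
             sf_image (sf_expz (Fpoly B0 v i) (- Bv i j)) p)))
          (sf_prod (fun i : 'I_n =>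
             sf_image (Q := S) (sf_expz (Fpoly B0 v i) (Bv i j))
               (fun i' => sf_mul S (fconst n (p i')) (fgen P i')))))
       (fmono P (cvec B0 v j))).
Proof.
move=> Psf Bskew v _ j.
exact: (@separation_with_coefficients (Semifield Psf) n B0 p v j Bskew).
Qed.
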